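(* Suppose that $L$ is locally operable and $(L,(f^\sharp)_{f\in E},F)$ is the corresponding partially pre-endomorphic Laver table. Then $(L,(f^\sharp)_{f\in E},F)$ is partially endomorphic if and only if for all $f,g\in E$ of arities $m$ and $n$ respectively, and all $\ell_1,\dots,\ell_m,u_1,\dots,u_n\in L$, $\mathrm{rank}(g,u_1,\dots,u_n)=0$ implies that $$\mathrm{rank}(g,f^\sharp(\ell_1,\dots,\ell_m,u_1),\dots,f^\sharp(\ell_1,\dots,\ell_m,u_n))=0.$$
   Context: Setting. $E,F$ are disjoint sets of function symbols, each $f\in E\cup F$ of arity $n_f$; $X$ is a set of variables. For $f\in E$, $x\in X$ let $f_x$ be a function symbol of arity $n_f$, and $\mathcal{G}=\{f_x\mid f\in E,x\in X\}\cup F$. $\mathbf{T}_{\mathcal{G}}(X)$ is the set of terms over $\mathcal{G}$ with variables in $X$, ordered by the subterm relation $\preceq$. $L\subseteq\mathbf{T}_{\mathcal{G}}(X)$ satisfies: $L$ is downwards closed under $\preceq$; $X\subseteq L$; $f_x(\ell_1,\dots,\ell_n)\in L$ iff $f_y(\ell_1,\dots,\ell_n)\in L$ for $x,y\in X$; and if $\mathfrak{g}\in F$ and $\ell_1,\dots,\ell_n\in L$ then $\mathfrak{g}(\ell_1,\dots,\ell_n)\in L$. Ranks. Let $\Omega=\{(f,\ell_1,\dots,\ell_{n_f})\mid f\in E,\ \ell_i\in L\}$. By transfinite recursion some elements of $\Omega$ get an ordinal rank, and $f^\sharp(\ell_1,\dots,\ell_{n_f},\ell)\in L$ is defined for all $\ell\in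 L$ as soon as $(f,\ell_1,\dots,\ell_{n_f})$ has a rank. If $f_x(\ell_1,\dots,\ell_{n_f})\notin L$, then $(f,\ell_1,\dots,\ell_{n_f})$ has rank $0$ and $f^\sharp(\ell_1,\dots,\ell_{n_f},\ell)=\ell$. For $\alpha>0$ and $w=(g,\ell_1,\dots,\ell_n)\in\Omega$ with no rank $<\alpha$, define a partial function $Q:L\to L$ by recursion on $\ell$: (i) $Q(x)=g_x(\ell_1,\dots,\ell_n)$ for $x\in X$; (ii) $Q(\mathfrak{f}(u_1,\dots,u_m))=\mathfrak{f}(Q(u_1),\dots,Q(u_m))$ for $\mathfrak{f}\in F$ if all $Q(u_i)$ are defined; (iii) $Q(f_x(u_1,\dots,u_m))=f^\sharp(Q(u_1),\dots,Q(u_m),g_x(\ell_1,\dots,\ell_n))$ for $f\in E$ if all $Q(u_i)$ are defined and $(f,Q(u_1),\dots,Q(u_m))$ has rank $<\alpha$; otherwise undefined. If $Q$ is total, $w$ has rank $\alpha$ and $g^\sharp(\ell_1,\dots,\ell_n,\ell)=Q(\ell)$. $L$ is operable if every element of $\Omega$ has a rank; then each $g^\sharp:L^{n_g+1}\to L$ is total. Locally operable. For finite $Y\subseteq X$, $U\subseteq E$, $V\subseteq F$ let $\mathcal{G}_{Y,U,V}=\{f_y\mid f\in U,y\in Y\}\cup V$ and $L_{Y,U,V}=\mathbf{T}_{\mathcal{G}_{Y,U,V}}(Y)\cap L$. $L$ is locally operable if all $L_{Y,U,V}$ are operable (with $Y,U,V$ in place of $X,E,F$). Then the operations $g^\sharp$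 of the sets $L_{Y,U,V}$ are restrictions of operations $g^\sharp:L^{n_g+1}\to L$ ($g\in E$), and $(L,(g^\sharp)_{g\in E},F)$, where symbols of $F$ act as term formation, is called a partially pre-endomorphic Laver table. In this setting $\mathrm{rank}(g,u_1,\dots,u_n)=0$ means $g_x(u_1,\dots,u_n)\notin L$. Partially endomorphic means: for all $f\in E$ and $\ell_1,\dots,\ell_{n_f}\in L$, the map $\ell\mapsto f^\sharp(\ell_1,\dots,\ell_{n_f},\ell)$ is an endomorphism of the algebra $(L,(g^\sharp)_{g\in E},F)$. *)

(* Defs.v *)
From HB Require Import structures.
From mathcomp Require Import all_boot.
From mathcomp Require Import boolp classical_sets functions cardinality.

Set Implicit Arguments.
Unset Strict Implicit.
Unset Printing Implicit Defensive.

Local Open Scope classical_set_scope.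

(* The sets X, E and F are the types [var], [Esym] and [Fsym]; E and F are
   disjoint because they are separate types. *)
Record signature := Signature {
  var : Type;
  Esym : Type;
  Fsym : Type;
  arE : Esym -> nat;
  arF : Fsym -> nat }.

(* Terms over G = {f_x | f in E, x in X} u F: the symbol f_x applied to us is
   [TE x us], with us : 'I_(arE f) -> term S.  Argument tuples are plain
   functions on 'I_n, so comparing them uses functional extensionality. *)
Inductive term (S : signature) : Type :=
| Var of var S
| TE (f : Esym S) of var S & ('I_(arE f) -> term S)
| TF (h : Fsym S) of ('I_(arF h) -> term S).

Arguments Var {S} _.
Arguments TE {S} f _ _.
Arguments TF {S} h _.

HB.instance Definition _ (S : signature) := gen_eqMixin (term S).
HB.instance Definition _ (S : signature) := gen_choiceMixin (term S).

Inductive subterm (S : signature) (s : term S) : term S -> Prop :=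
| subterm_refl : subterm s s
| subterm_TE f x us i : subterm s (us i) -> subterm s (TE f x us)
| subterm_TF h us i : subterm s (us i) -> subterm s (TF h us).

Record laver_carrier (S : signature) (L : set (term S)) : Prop := {
  carrier_down : forall s t, subterm s t -> L t -> L s;
  carrier_var : forall x, L (Var x);
  carrier_E : forall (f : Esym S) (x y : var S) (ls : 'I_(arE f) -> term S),
    L (TE f x ls) <-> L (TE f y ls);
  carrier_F : forall (h : Fsym S) (ls : 'I_(arF h) -> term S),
    (forall i, L (ls i)) -> L (TF h ls) }.

(* Every ordinal is represented as osup h, the least ordinal strictly above
   all the h i; one ordinal has several representations, identified by
   [ole a b /\ ole b a]. *)
Inductive ord : Type := osup (A : Type) (h : A -> ord).

Fixpoint ole (a b : ord) {struct a} : Prop :=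
  match a, b with
  | osup A h, osup B k => forall i : A, exists j : B, ole (h i) (k j)
  end.

Definition olt (a b : ord) : Prop :=
  match b with osup B k => exists j : B, ole a (k j) end.

Definition ozero (a : ord) : Prop := ~ exists b, olt b a.

Lemma ole_trans (a b c : ord) : ole a b -> ole b c -> ole a c.
Proof.
elim: a b c => A h IH [B k] [C l] /= ab bc i.
have [j hj] := ab i; have [m hm] := bc j.
by exists m; apply: IH hj hm.
Qed.

Lemma olt_wf : well_founded olt.
Proof.
suff H b a : ole a b -> Acc olt a.
  move=> a; apply: (H a).
  by elim: a => A h IH /= i; exists i; apply: IH.
elim: b a => B k IH [A h] /= ab; constructor => c /= [i ci].
by have [j hj] := ab i; apply: (IH j); apply: ole_trans ci hj.
Qed.

(* No f_x(ls) lies in M.  When M is closed under changing x in f_x, this does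
   not depend on x. *)
Definition rank_zero (S : signature) (M : set (term S))
    (g : Esym S) (ls : 'I_(arE g) -> term S) : Prop :=
  forall x, ~ M (TE g x ls).

Arguments rank_zero {S} M g ls.

(* The construction below applies both to L itself and to the sets L_{Y,U,V}:
   M stands for the set of terms and U for the set of symbols that play the
   role of E.  The sets that play the roles of X and F can be read off M. *)
Definition Omega (S : signature) (U : set (Esym S)) (M : set (term S))
    (g : Esym S) (ls : 'I_(arE g) -> term S) : Prop :=
  U g /\ forall i, M (ls i).

Arguments Omega {S} U M g ls.

(* The graph of the partial map Q : M -> M attached to (g, ls).  [prior vs t r]
   means that (f, vs) has rank < alpha and f#(vs, t) = r. *)
Inductive Qgraph (S : signature) (M : set (term S))
    (prior : forall f : Esym S,
       ('I_(arE f) -> term S) -> term S -> term S -> Prop)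
    (g : Esym S) (ls : 'I_(arE g) -> term S) : term S -> term S -> Prop :=
| Q_var x : M (Var x) -> Qgraph M prior ls (Var x) (TE g x ls)
| Q_F h us vs : M (TF h us) ->
    (forall i, Qgraph M prior ls (us i) (vs i)) ->
    Qgraph M prior ls (TF h us) (TF h vs)
| Q_E f x us vs r : M (TE f x us) ->
    (forall i, Qgraph M prior ls (us i) (vs i)) ->
    prior f vs (TE g x ls) r ->
    Qgraph M prior ls (TE f x us) r.

Arguments Qgraph {S} M prior g ls _ _.

(* For a fixed ordinal alpha: which (g, ls) have rank alpha, and for these the
   graph of l |-> g#(ls, l). *)
Record stage (S : signature) := Stage {
  at_rank : forall g : Esym S, ('I_(arE g) -> term S) -> Prop;
  at_graph : forall g : Esym S,
    ('I_(arE g) -> term S) -> term S -> term S -> Prop }.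

Arguments at_rank {S} _ g ls.
Arguments at_graph {S} _ g ls _ _.

Definition stage_step (S : signature) (U : set (Esym S)) (M : set (term S))
    (alpha : ord) (prev : forall beta, olt beta alpha -> stage S) : stage S :=
  let prior f (vs : 'I_(arE f) -> term S) t r :=
    exists beta (lt : olt beta alpha),
      at_rank (prev beta lt) f vs /\ at_graph (prev beta lt) f vs t r in
  Stage
    (fun g ls => Omega U M g ls /\
      (ozero alpha /\ rank_zero M g ls \/
       [/\ ~ ozero alpha,
           forall beta (lt : olt beta alpha), ~ at_rank (prev beta lt) g ls
         & forall l, M l -> exists r, Qgraph M prior g ls l r]))
    (fun g ls l r =>
       ozero alpha /\ M l /\ r = l \/
       ~ ozero alpha /\ Qgraph M prior g ls l r).

Definition stage_at (S : signature) (U : set (Esym S)) (M : set (term S)) :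
    ord -> stage S :=
  Fix olt_wf (fun=> stage S) (stage_step U M).

Lemma stage_atE (S : signature) (U : set (Esym S)) (M : set (term S)) alpha :
  stage_at U M alpha = stage_step U M (fun beta (_ : olt beta alpha) =>
                                         stage_at U M beta).
Proof.
rewrite /stage_at Fix_eq // => a F G FG; congr stage_step.
by apply: functional_extensionality_dep => b;
  apply: functional_extensionality_dep => lt; apply: FG.
Qed.

Definition has_rank (S : signature) (U : set (Esym S)) (M : set (term S))
    (alpha : ord) (g : Esym S) (ls : 'I_(arE g) -> term S) : Prop :=
  at_rank (stage_at U M alpha) g ls.

Arguments has_rank {S} U M alpha g ls.

Definition sharp_graph (S : signature) (U : set (Esym S)) (M : set (term S))
    (g : Esym S) (ls : 'I_(arE g) -> term S) (l r : term S) : Prop :=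
  exists alpha, has_rank U M alpha g ls /\
    at_graph (stage_at U M alpha) g ls l r.

Arguments sharp_graph {S} U M g ls l r.

Definition operable (S : signature) (U : set (Esym S)) (M : set (term S)) :
    Prop :=
  forall (g : Esym S) (ls : 'I_(arE g) -> term S), Omega U M g ls ->
    exists alpha, has_rank U M alpha g ls.

Fixpoint term_over (S : signature) (Y : set (var S)) (U : set (Esym S))
    (V : set (Fsym S)) (t : term S) : Prop :=
  match t with
  | Var x => Y x
  | TE f x us => [/\ U f, Y x & forall i, term_over Y U V (us i)]
  | TF h us => V h /\ forall i, term_over Y U V (us i)
  end.

(* L_{Y,U,V} *)
Definition local_part (S : signature) (L : set (term S)) (Y : set (var S))
    (U : set (Esym S)) (V : set (Fsym S)) : set (term S) :=
  [set t | term_over Y U V t /\ L t].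

Definition locally_operable (S : signature) (L : set (term S)) : Prop :=
  forall (Y : set (var S)) (U : set (Esym S)) (V : set (Fsym S)),
    finite_set Y -> finite_set U -> finite_set V ->
    operable U (local_part L Y U V).

(* g#(ls, l), computed in any L_{Y,U,V} with Y, U, V finite, g in U and ls, l
   in L_{Y,U,V}.  The default value l only matters where there is no such
   value, in particular outside L. *)
Definition sharp (S : signature) (L : set (term S)) (g : Esym S)
    (ls : 'I_(arE g) -> term S) (l : term S) : term S :=
  xget l [set r | exists (Y : set (var S)) (U : set (Esym S))
                         (V : set (Fsym S)),
    [/\ finite_set Y, finite_set U & finite_set V] /\
    [/\ Omega U (local_part L Y U V) g ls, local_part L Y U V l
      & sharp_graph U (local_part L Y U V) g ls l r]].

Arguments sharp {S} L g ls l.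

(* phi restricts to an endomorphism of the algebra (L, (op g)_{g in E}, F),
   where op g has arity arE g + 1. *)
Definition endomorphism (S : signature) (L : set (term S))
    (op : forall g : Esym S,
       ('I_(arE g) -> term S) -> term S -> term S)
    (phi : term S -> term S) : Prop :=
  [/\ forall l, L l -> L (phi l),
      forall (g : Esym S) (us : 'I_(arE g) -> term S) (u : term S),
        (forall i, L (us i)) -> L u ->
        phi (op g us u) = op g (fun i => phi (us i)) (phi u)
    & forall (h : Fsym S) (us : 'I_(arF h) -> term S),
        (forall i, L (us i)) ->
        phi (TF h us) = TF h (fun i => phi (us i))].

Definition partially_endomorphic (S : signature) (L : set (term S))
    (op : forall g : Esym S,
       ('I_(arE g) -> term S) -> term S -> term S) : Prop :=
  forall (f : Esym S) (ls : 'I_(arE f) -> term S),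
    (forall i, L (ls i)) -> endomorphism L op (op f ls).

(* Main.v *)
(** Write [phi = f#(ls, .)].  If [phi] is an endomorphism and [(g, us)] has
    rank 0, then [psi = g#(phi us, .)] satisfies [psi (phi l) = phi l], so [psi]
    fixes its own parameters [phi us].  If [(g, phi us)] had positive rank, then
    [g_x(phi us)] would lie in [L], and computing [psi] on it would require
    [(g, psi (phi us)) = (g, phi us)] to have a rank below its own.

    Conversely, [phi (g#(us, u)) = g#(phi us, phi u)] is proved by induction on
    the rank of [(f, ls)], then on the rank of [(g, us)], then on [u], inside a
    finite local part.  The hypothesis settles the case in which [(g, us)] has
    rank 0.  For [u = h_x(ws)] with both ranks positive, the two sides unfold to
    the distributivity of [phi] over [h#(g#(us, ws), .)] and that of
    [g#(phi us, .)] over [h#(phi ws, .)]; here [(h, g#(us, ws))] has smaller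
    rank than [(g, us)] and [(g, phi us)] has smaller rank than [(f, ls)]. *)

Require Import Defs.
From mathcomp Require Import all_boot.
From mathcomp Require Import boolp classical_sets cardinality.

Set Implicit Arguments.
Unset Strict Implicit.
Unset Printing Implicit Defensive.

Local Open Scope classical_set_scope.

(** * Finite supports of terms *)

Section Terms.
Variable S : signature.
Implicit Types (Y : set (var S)) (U : set (Esym S)) (V : set (Fsym S)).

Lemma term_over_sub Y U V Y' U' V' (t : term S) :
  Y `<=` Y' -> U `<=` U' -> V `<=` V' ->
  term_over Y U V t -> term_over Y' U' V' t.
Proof.
move=> sY sU sV; elim: t => [x|f x us IH|h us IH] /=; first exact: sY.
- by case=> /sU ? /sY ? o; split=> // i; apply: IH.
- by case=> /sV ? o; split=> // i; apply: IH.
Qed.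

Definition finitely_over (T : Type) (ts : T -> term S) : Prop :=
  exists Y U V, [/\ finite_set Y, finite_set U & finite_set V] /\
    forall i, term_over Y U V (ts i).

(** Finitely many finite sets have a finite union, so the symbols of the separate terms can be
    pooled. *)
Lemma finitely_over_family n (ts : 'I_n -> term S) :
  (forall i, finitely_over (fun _ : unit => ts i)) -> finitely_over ts.
Proof.
move=> /choice[Y] /choice[U] /choice[V] H.
exists (\bigcup_(i in [set: 'I_n]) Y i), (\bigcup_(i in [set: 'I_n]) U i),
  (\bigcup_(i in [set: 'I_n]) V i); split.
  by split; apply: bigcup_finite => // i _; have [[]] := H i.
move=> i; have [_ /(_ tt)] := H i.
by apply: term_over_sub => a ai; exists i.
Qed.

Lemma finitely_over1 (t : term S) : finitely_over (fun _ : unit => t).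
Proof.
elim: t => [x|f x us /finitely_over_family|h us /finitely_over_family].
- by exists [set x], set0, set0.
- case=> Y [U [V [[fY fU fV] o]]].
  exists (x |` Y), (f |` U), V; split; first by split; rewrite ?finite_setU.
  move=> _; split; [by left|by left|] => i.
  by apply: term_over_sub (o i) => // a; right.
- case=> Y [U [V [[fY fU fV] o]]].
  exists Y, U, (h |` V); split; first by split; rewrite ?finite_setU.
  move=> _; split; [by left|] => i.
  by apply: term_over_sub (o i) => // a; right.
Qed.

Lemma finitely_over_tuple n (ts : n.-tuple (term S)) :
  finitely_over (tnth ts).
Proof. by apply: finitely_over_family => i; apply: finitely_over1. Qed.

End Terms.

(** * The rank-free recursion and its determinism *)

Section Evaluation.
Variables (S : signature) (L : set (term S)).

(* The recursion defining g#, with the ranks forgotten: it mentions no local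
   part, so determinism makes the operations of all local parts agree. *)
Inductive evaluates (g : Esym S) (ls : 'I_(arE g) -> term S) :
    term S -> term S -> Prop :=
| eval_zero l : rank_zero L g ls -> evaluates ls l l
| eval_var x : ~ rank_zero L g ls -> evaluates ls (Var x) (TE g x ls)
| eval_F h us vs : ~ rank_zero L g ls ->
    (forall i, evaluates ls (us i) (vs i)) ->
    evaluates ls (TF h us) (TF h vs)
| eval_E f x us vs r : ~ rank_zero L g ls ->
    (forall i, evaluates ls (us i) (vs i)) ->
    @evaluates f vs (TE g x ls) r ->
    evaluates ls (TE f x us) r.

Lemma evaluates_inv g (ls : 'I_(arE g) -> term S) l r :
  evaluates ls l r -> ~ rank_zero L g ls ->
  match l with
  | Var x => r = TE g x ls
  | TF h us => exists2 vs,
      forall i, evaluates ls (us i) (vs i) & r = TF h vs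
  | TE f x us => exists2 vs : 'I_(arE f) -> term S,
      forall i, evaluates ls (us i) (vs i) & evaluates vs (TE g x ls) r
  end.
Proof. by case=> // *; eexists; eauto. Qed.

Lemma evaluates_zero g (ls : 'I_(arE g) -> term S) l r :
  rank_zero L g ls -> evaluates ls l r -> r = l.
Proof. by move=> z []. Qed.

Lemma evaluates_fun g (ls : 'I_(arE g) -> term S) l r r' :
  evaluates ls l r -> evaluates ls l r' -> r = r'.
Proof.
move=> e; elim: e r' => {g ls l r}.
- by move=> g ls l z r' /evaluates_zero ->.
- by move=> g ls x nz r' /evaluates_inv ->.
- move=> g ls h us vs nz _ IH r' /evaluates_inv /(_ nz) [ws /= e ->].
  by congr TF; apply: functional_extensionality_dep => i; apply: IH.
- move=> g ls f x us vs r nz _ IHu _ IHr r' /evaluates_inv /(_ nz) [ws /= e].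
  have -> : ws = vs.
    by apply: functional_extensionality_dep => i; apply/esym/IHu.
  exact: IHr.
Qed.

(** Without variables there are no symbols [f_x] either, so the recursion only descends through
    symbols of [F]. *)
Lemma evaluates_varfree g (ls : 'I_(arE g) -> term S) U V l :
  term_over set0 U V l -> evaluates ls l l.
Proof.
have [z _|nz] := EM (rank_zero L g ls); first exact: eval_zero.
elim: l => [x []|f x us _ []//|h us IH [_ o]].
by apply: eval_F nz _ => i; apply: IH (o i).
Qed.

End Evaluation.

(** * Unfolding the transfinite recursion *)

Lemma olt_ozero (alpha : ord) :
  ~ ozero alpha -> exists beta, ozero beta /\ olt beta alpha.
Proof.
move=> /contrapT[b]; case: alpha => A h /= [i _].
(* The supremum of the empty family represents zero and is [ole] every ordinal, here [h i]. *)
exists (osup (fun x : False => match x with end)); split; first by case=> ? [].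
by exists i; case: (h i) => B k [].
Qed.

Section Ranks.
Variables (S : signature) (U : set (Esym S)) (M : set (term S)).

Definition ranked_below (alpha : ord) (f : Esym S)
    (vs : 'I_(arE f) -> term S) (t r : term S) : Prop :=
  exists beta (_ : olt beta alpha),
    has_rank U M beta f vs /\ at_graph (stage_at U M beta) f vs t r.

Lemma has_rankE alpha g (ls : 'I_(arE g) -> term S) :
  has_rank U M alpha g ls <->
  Omega U M g ls /\
   (ozero alpha /\ rank_zero M g ls \/
    [/\ ~ ozero alpha,
        forall beta (lt : olt beta alpha), ~ has_rank U M beta g ls
      & forall l, M l -> exists r, Qgraph M (ranked_below alpha) g ls l r]).
Proof. by rewrite {1}/has_rank stage_atE. Qed.

Lemma at_graphE alpha g (ls : 'I_(arE g) -> term S) l r :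
  at_graph (stage_at U M alpha) g ls l r <->
  ozero alpha /\ M l /\ r = l \/
  ~ ozero alpha /\ Qgraph M (ranked_below alpha) g ls l r.
Proof. by rewrite stage_atE. Qed.

(** Minimality of ranks: if [rank_zero M g ls] held at a nonzero [alpha], then a zero ordinal below
    [alpha] would already be a rank of [(g, ls)]. *)
Lemma has_rank_zero alpha g (ls : 'I_(arE g) -> term S) :
  has_rank U M alpha g ls -> (ozero alpha <-> rank_zero M g ls).
Proof.
move=> /has_rankE[om H]; split=> [z|z].
  by case: H => [[]|[]].
case: H => [[]//|[nz min _]].
have [b [bz ba]] := olt_ozero nz.
by case: (min b ba); apply/has_rankE; split=> //; left.
Qed.

Lemma has_rank_total alpha g (ls : 'I_(arE g) -> term S) l :
  has_rank U M alpha g ls -> M l ->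
  exists r, at_graph (stage_at U M alpha) g ls l r.
Proof.
move=> /has_rankE[_ [[z _]|[nz _ tot]]] Ml.
  by exists l; apply/at_graphE; left.
by have [r q] := tot l Ml; exists r; apply/at_graphE; right.
Qed.

Lemma Qgraph_inv prior g (ls : 'I_(arE g) -> term S) l r :
  Qgraph M prior g ls l r ->
  match l with
  | TE f x us => exists2 vs : 'I_(arE f) -> term S,
      forall i, Qgraph M prior g ls (us i) (vs i) & prior f vs (TE g x ls) r
  | _ => True
  end.
Proof. by case=> // *; eexists; eauto. Qed.

End Ranks.

(** * Soundness of the local operations *)

Section Local.
Variables (S : signature) (L : set (term S)) (hL : laver_carrier L).
Variables (Y : set (var S)) (U : set (Esym S)) (V : set (Fsym S)).
Let M := local_part L Y U V.

Lemma local_TE_inv f x (us : 'I_(arE f) -> term S) :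
  M (TE f x us) -> [/\ Y x, Omega U M f us & ~ rank_zero L f us].
Proof.
case=> /= -[Uf Yx o] Lt; split=> //; last by move/(_ x).
split=> // i; split=> //.
by apply: (carrier_down hL) Lt; apply: subterm_TE (subterm_refl _).
Qed.

Lemma local_TF_inv h (us : 'I_(arF h) -> term S) :
  M (TF h us) -> V h /\ forall i, M (us i).
Proof.
case=> /= -[Vh o] Lt; split=> // i; split=> //.
by apply: (carrier_down hL) Lt; apply: subterm_TF (subterm_refl _).
Qed.

Lemma rank_pos_TE g x (ls : 'I_(arE g) -> term S) :
  ~ rank_zero L g ls -> L (TE g x ls).
Proof.
by move=> /existsNP[y /contrapT Ly]; apply: (carrier_E hL y x ls).1 Ly.
Qed.

Lemma local_TE g x (ls : 'I_(arE g) -> term S) :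
  ~ rank_zero L g ls -> Omega U M g ls -> Y x -> M (TE g x ls).
Proof.
move=> nz [Ug o] Yx; split; last exact: rank_pos_TE.
by split=> // i; case: (o i).
Qed.

(** By induction on the rank, values computed in a local part obey a recursion that does not mention
    [Y], [U] or [V]; this makes different local parts comparable. *)
Lemma local_graph_sound alpha g (ls : 'I_(arE g) -> term S) l r :
  has_rank U M alpha g ls -> at_graph (stage_at U M alpha) g ls l r ->
  evaluates L ls l r /\ M r.
Proof.
elim/(well_founded_induction olt_wf): alpha g ls l r => alpha IH g ls l r.
move=> hr; have [om _] := (has_rankE _ _ _ _).1 hr.
move=> /at_graphE[[z [Ml ->]]|[nz q]].
  (* Rank 0 in M but not in L forces Y to be empty; then l has no variables
     and hence no symbols f_x. *)
  split=> //; have [zL|nzL] := EM (rank_zero L g ls); first exact: eval_zero.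
  apply: (@evaluates_varfree _ _ _ _ U V); case: Ml => o _.
  apply: term_over_sub o => // y Yy /=.
  have /(has_rank_zero hr)/(_ y) := z; case.
  exact: local_TE.
(* Rank 0 in [L] would give rank 0 in the subset [M]. *)
have nzL : ~ rank_zero L g ls.
  by move=> zL; apply: nz; apply/(has_rank_zero hr) => x [_ /zL].
elim: q => {l r}.
- move=> x [Yx _]; split; first exact: eval_var.
  exact: local_TE.
- move=> h us vs /local_TF_inv[Vh _] _ /all_and2[e o]; split.
    exact: eval_F.
  split; first by split=> // i; case: (o i).
  by apply: (carrier_F hL) => i; case: (o i).
- move=> f x us vs r _ _ /all_and2[e _] [beta [lt [hrf gf]]].
  by have [e' Mr] := IH _ lt _ _ _ _ hrf gf; split=> //; apply: eval_E e'.
Qed.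

End Local.

(** * The operations [sharp] on local parts, and induction on rank *)

Section LocalSharp.
Variables (S : signature) (L : set (term S)) (hL : laver_carrier L).

(** The choice made by [xget] is harmless: all candidates are values of [evaluates], which is
    deterministic. *)
Lemma sharp_member g (ls : 'I_(arE g) -> term S) l r Y U V :
  finite_set Y -> finite_set U -> finite_set V ->
  Omega U (local_part L Y U V) g ls -> local_part L Y U V l ->
  sharp_graph U (local_part L Y U V) g ls l r -> sharp L g ls l = r.
Proof.
move=> fY fU fV om Ml gr; rewrite /sharp.
case: xgetP => [r' _|/(_ r)[]]; last by exists Y, U, V.
case=> Y' [U' [V' [_ [_ _ [a' [hr' gr']]]]]]; case: gr => a [hr gr].
have [e _] := local_graph_sound hL hr gr.
have [e' _] := local_graph_sound hL hr' gr'.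
exact: evaluates_fun e' e.
Qed.

(** This holds on all terms, because the default value of [xget] is [l] as well. *)
Lemma sharp_zero g (ls : 'I_(arE g) -> term S) :
  rank_zero L g ls -> sharp L g ls = id.
Proof.
move=> z; apply: functional_extensionality_dep => l.
rewrite /sharp; case: xgetP => // r _.
case=> Y [U [V [_ [_ _ [a [hr gr]]]]]].
have [e _] := local_graph_sound hL hr gr.
exact: evaluates_zero e.
Qed.

Hypothesis hop : locally_operable L.
Variables (Y : set (var S)) (U : set (Esym S)) (V : set (Fsym S)).
Hypotheses (fY : finite_set Y) (fU : finite_set U) (fV : finite_set V).
Let M := local_part L Y U V.

Lemma local_sharp g (ls : 'I_(arE g) -> term S) l :
  Omega U M g ls -> M l ->
  evaluates L ls l (sharp L g ls l) /\ M (sharp L g ls l).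
Proof.
move=> om Ml; have [a hr] := hop fY fU fV om.
have [r gr] := has_rank_total hr Ml.
rewrite (@sharp_member g ls l r Y U V) //; last by exists a.
exact: local_graph_sound hr gr.
Qed.

(** Induction on the rank, stated without ordinals: the recursion for [g#(ls, .)] at [f_x(us)] calls
    [(f, g#(ls, us))], which therefore has smaller rank than [(g, ls)]. *)
Lemma local_ind (P : forall g, ('I_(arE g) -> term S) -> Prop) :
  (forall g ls, Omega U M g ls ->
    (forall f x us, ~ rank_zero L g ls -> M (TE f x us) ->
      Omega U M f (fun i => sharp L g ls (us i)) ->
      P f (fun i => sharp L g ls (us i))) ->
    P g ls) ->
  forall g ls, Omega U M g ls -> P g ls.
Proof.
move=> IHP g ls om; have [a hr] := hop fY fU fV om.
elim/(well_founded_induction olt_wf): a g ls om hr => a IH g ls om hr.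
apply: IHP => // f x us nz MT oms.
have [Yx [_ Mus] _] := local_TE_inv hL MT.
have nza : ~ ozero a.
  by move=> /(has_rank_zero hr)/(_ x); apply; apply: local_TE.
have [r gr] := has_rank_total hr MT.
have := gr; move=> /at_graphE[[//]|[_ /Qgraph_inv[vs q [b [lt [hrf _]]]]]].
(* The arguments [vs] of the recursive call are values of [sharp], so the smaller rank [b] belongs
   to the pair in the goal. *)
suff vsE : (fun i => sharp L g ls (us i)) = vs.
  by apply: (IH b lt) => //; rewrite vsE.
apply: functional_extensionality_dep => i.
apply: (@sharp_member _ _ _ _ Y U V) => //.
by exists a; split=> //; apply/at_graphE; right.
Qed.

(* If g#(ls, .) fixed all the ls, then the case g_x(ls) of its recursion would
   give (g, ls) a rank smaller than its own. *)
Lemma local_sharp_moves g (ls : 'I_(arE g) -> term S) :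
  Omega U M g ls -> Y !=set0 -> (forall i, sharp L g ls (ls i) = ls i) ->
  rank_zero L g ls.
Proof.
move=> om [x Yx]; apply: contraPP => nz; move: nz.
elim/local_ind: om => {}g {}ls om IH nz fix_ls.
have E : (fun i => sharp L g ls (ls i)) = ls.
  exact: functional_extensionality_dep.
have := IH g x ls nz (local_TE hL nz om Yx); rewrite E.
by move/(_ om nz); apply=> i; rewrite !fix_ls.
Qed.

End LocalSharp.

(** * Recursion equations on [L] and the two implications *)

Section Global.
Variables (S : signature) (L : set (term S)) (hL : laver_carrier L).
Hypothesis hop : locally_operable L.

(** Including [g_x(ls)] puts [x] into [Y] and [(g, ls)] into the local [Omega]. *)
Lemma common_local_part x g (ls : 'I_(arE g) -> term S) n
    (ts : n.-tuple (term S)) :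
  L (TE g x ls) -> (forall i, L (tnth ts i)) ->
  exists Y U V, [/\ finite_set Y, finite_set U & finite_set V] /\
    local_part L Y U V (TE g x ls) /\
    forall i, local_part L Y U V (tnth ts i).
Proof.
move=> LT Lts.
have [Y [U [V [fin o]]]] := finitely_over_tuple (cons_tuple (TE g x ls) ts).
exists Y, U, V; split=> //; split; first by split=> //; apply: (o ord0).
by move=> i; split=> //; have := o (lift ord0 i); rewrite tnthS.
Qed.

(** For positive rank some [g_x(ls)] lies in [L], and a finite local part containing it and [l]
    computes the value; rank 0 is treated apart. *)
Lemma sharp_eval g (ls : 'I_(arE g) -> term S) l :
  (forall i, L (ls i)) -> L l ->
  evaluates L ls l (sharp L g ls l) /\ L (sharp L g ls l).
Proof.
move=> Lls Ll; have [z|nz] := EM (rank_zero L g ls).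
  by rewrite (sharp_zero hL z); split=> //; apply: eval_zero.
have /existsNP[x /contrapT LT] := nz.
have [|Y [U [V [[fY fU fV] [MT Ml]]]]] :=
    common_local_part (ts := [tuple l]) LT.
  by move=> i; rewrite (tnth_nth l) ord1.
have [_ om _] := local_TE_inv hL MT.
by have [e []] := local_sharp hL hop fY fU fV om (Ml ord0).
Qed.

Lemma sharp_var g (ls : 'I_(arE g) -> term S) x :
  (forall i, L (ls i)) -> ~ rank_zero L g ls ->
  sharp L g ls (Var x) = TE g x ls.
Proof.
move=> Lls nz; have [e _] := sharp_eval Lls (carrier_var hL x).
exact: (evaluates_inv e nz).
Qed.

Lemma sharp_F g (ls : 'I_(arE g) -> term S) h us :
  (forall i, L (ls i)) -> (forall i, L (us i)) ->
  sharp L g ls (TF h us) = TF h (fun i => sharp L g ls (us i)).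
Proof.
move=> Lls Lus; have [z|nz] := EM (rank_zero L g ls).
  by rewrite (sharp_zero hL z).
have [e _] := sharp_eval Lls (carrier_F hL Lus).
apply: evaluates_fun e _; apply: eval_F => // i.
by have [] := sharp_eval Lls (Lus i).
Qed.

Lemma sharp_E g (ls : 'I_(arE g) -> term S) f x us :
  (forall i, L (ls i)) -> ~ rank_zero L g ls -> L (TE f x us) ->
  sharp L g ls (TE f x us) =
  sharp L f (fun i => sharp L g ls (us i)) (TE g x ls).
Proof.
move=> Lls nz LT; have [e _] := sharp_eval Lls LT.
have Lus i : L (us i).
  by apply: (carrier_down hL) LT; apply: subterm_TE (subterm_refl _).
have LTg := rank_pos_TE hL x nz.
apply: evaluates_fun e _; apply: eval_E nz _ _.
  by move=> i; have [/[swap] _] := sharp_eval Lls (Lus i); apply.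
by have [] := sharp_eval (fun i => (sharp_eval Lls (Lus i)).2) LTg.
Qed.

Lemma partially_endomorphic_rank_zero f g (ls : 'I_(arE f) -> term S)
    (us : 'I_(arE g) -> term S) :
  endomorphism L (sharp L) (sharp L f ls) ->
  (forall i, L (us i)) -> rank_zero L g us ->
  rank_zero L g (fun i => sharp L f ls (us i)).
Proof.
case=> closed morph _ Lus z; set vs := fun i => _.
apply: contrapT => nz; have /existsNP[x /contrapT LT] := nz; apply: nz.
have [[]//|Y [U [V [[fY fU fV] [MT _]]]]] :=
  common_local_part (ts := [tuple]) LT.
have [Yx om _] := local_TE_inv hL MT.
apply: (local_sharp_moves hL hop fY fU fV om); first by exists x.
(* Since [g#(us, .)] is the identity, the morphism law at [us i] reads [vs i = g#(vs, vs i)]. *)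
by move=> i; rewrite /vs -(morph g us) // (sharp_zero hL z).
Qed.

Hypothesis preserve : forall (f g : Esym S) (ls : 'I_(arE f) -> term S)
    (us : 'I_(arE g) -> term S),
  (forall i, L (ls i)) -> (forall i, L (us i)) -> rank_zero L g us ->
  rank_zero L g (fun i => sharp L f ls (us i)).

Lemma local_distributive Y U V :
  finite_set Y -> finite_set U -> finite_set V ->
  let M := local_part L Y U V in
  forall f ls, Omega U M f ls -> forall g us, Omega U M g us ->
  forall u, M u ->
  sharp L f ls (sharp L g us u) =
  sharp L g (fun i => sharp L f ls (us i)) (sharp L f ls u).
Proof.
move=> fY fU fV M f ls omf; move: (omf).
have ML t : M t -> L t by case.
have Mclosed k ks t : Omega U M k ks -> M t -> M (sharp L k ks t).
  by move=> om Mt; have [] := local_sharp hL hop fY fU fV om Mt.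
elim/(local_ind hL hop fY fU fV): omf => {f ls} f ls _ IHf omf g us omg.
move: (omg); elim/(local_ind hL hop fY fU fV): omg => {g us} g us _ IHg omg.
have Lls i : L (ls i) by apply/ML/omf.2.
have Lus i : L (us i) by apply/ML/omg.2.
have [zf|nzf] := EM (rank_zero L f ls).
  by move=> u _; rewrite (sharp_zero hL zf).
have [zg|nzg] := EM (rank_zero L g us).
  by move=> u _; rewrite (sharp_zero hL zg) (sharp_zero hL (preserve _ _ zg)).
pose vs i := sharp L f ls (us i); rewrite -/vs.
have omv : Omega U M g vs by split; [case: omg|move=> i; apply/Mclosed/omg.2].
have Lvs i : L (vs i) by apply/ML/omv.2.
elim=> [x|h x ws IHw|h ws IHw] Mu.
(* Both sides are [g#(vs, f_x(ls))]; on the left this is the recursion of [f#(ls, .)] at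
   [g_x(us)]. *)
- have Yx : Y x by case: Mu.
  have MT := local_TE hL nzg omg Yx.
  by rewrite !sharp_var // sharp_E //; apply: ML.
- have [Yx omh _] := local_TE_inv hL Mu.
  have MT := local_TE hL nzg omg Yx; have MTf := local_TE hL nzf omf Yx.
  have omgw : Omega U M h (fun i => sharp L g us (ws i)).
    by split; [case: omh|move=> i; apply/Mclosed/omh.2].
  have omfw : Omega U M h (fun i => sharp L f ls (ws i)).
    by split; [case: omh|move=> i; apply/Mclosed/omh.2].
  rewrite (sharp_E Lus nzg (ML _ Mu)) (sharp_E Lls nzf (ML _ Mu)).
  (* Left side: [f#(ls, .)] distributes over [h#(g#(us, ws), g_x(us))]. *)
  rewrite (IHg h x ws nzg Mu omgw omgw _ MT).
  (* Right side: [g#(vs, .)] distributes over [h#(f#(ls, ws), f_x(ls))]. *)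
  rewrite (IHf g x us nzf MT omv omv _ _ omfw _ MTf).
  (* The last arguments now agree by the recursion of [f#(ls, .)] at [g_x(us)]; the others are the
     induction hypothesis on [u]. *)
  rewrite (sharp_E Lls nzf (ML _ MT)) -/vs; congr sharp.
  apply: functional_extensionality_dep => i; apply: IHw.
  exact: omh.2.
- have [_ Mws] := local_TF_inv hL Mu.
  have Lws i : L (ws i) := ML _ (Mws i).
  have Lsw k ks i : Omega U M k ks -> L (sharp L k ks (ws i)).
    by move=> om; apply: ML; apply: Mclosed om (Mws i).
  rewrite (sharp_F Lus Lws) (sharp_F Lls Lws) !sharp_F //;
    try by move=> i; apply: Lsw.
  by congr TF; apply: functional_extensionality_dep => i; apply: IHw (Mws i).
Qed.

Lemma sharp_endomorphism f (ls : 'I_(arE f) -> term S) :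
  (forall i, L (ls i)) -> endomorphism L (sharp L) (sharp L f ls).
Proof.
move=> Lls; split; last by move=> h us Lus; apply: sharp_F.
  by move=> l Ll; have [] := sharp_eval Lls Ll.
move=> g us u Lus Lu.
have [zg|nzg] := EM (rank_zero L g us).
  by rewrite (sharp_zero hL zg) (sharp_zero hL (preserve _ _ zg)).
have [zf|nzf] := EM (rank_zero L f ls).
  by rewrite (sharp_zero hL zf).
have /existsNP[x /contrapT LTf] := nzf.
have LTg := rank_pos_TE hL x nzg.
(* With both ranks positive, one finite local part contains [f_x(ls)], [g_x(us)] and [u]. *)
have [|Y [U [V [[fY fU fV] [MT Mt]]]]] :=
    common_local_part (ts := [tuple TE g x us; u]) LTf.
  by case=> -[|[|[]]].
have [_ omf _] := local_TE_inv hL MT.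
have [_ omg _] := local_TE_inv hL (Mt ord0).
exact: (local_distributive fY fU fV omf omg (Mt ord_max)).
Qed.

End Global.

Theorem theorem4p19 (S : signature) (L : set (term S))
    (hL : laver_carrier L) (hop : locally_operable L) :
  partially_endomorphic L (sharp L) <->
  (forall (f g : Esym S) (ls : 'I_(arE f) -> term S)
          (us : 'I_(arE g) -> term S),
     (forall i, L (ls i)) -> (forall i, L (us i)) ->
     rank_zero L g us ->
     rank_zero L g (fun i => sharp L f ls (us i))).
Proof.
split=> [endo f g ls us Lls Lus|preserve f ls Lls].
  by apply: partially_endomorphic_rank_zero => //; apply: endo.
exact: sharp_endomorphism.
Qed.
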